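(* Let $p\ge 5$ be a prime and let $r$ be an integer with $1\le r\le p-1$ such that either $3r+1$ is a quadratic non-residue modulo $p$ or $3r+1\equiv 0\pmod p$. Then for all integers $n\ge 0$ and all integers $k\ge j\ge 0$, \[ a_{p(k-j)+(p-3),\;pk+(p+2)}(pn+r)\equiv 0 \pmod p. \]
   Context: For positive integers $r,s$, $a_{r,s}(n)$ denotes the number of multicolored partitions of $n$ in which each even part may appear in one of $r$ colors and each odd part may appear in one of $s$ colors (copies of the same part size in different colors are distinct), with $a_{r,s}(0)=1$. Equivalently, for $|q|<1$, $\sum_{n\ge0}a_{r,s}(n)q^n = f_2^{s-r}/f_1^{s}$, where $f_m=\prod_{i\ge1}(1-q^{mi})$. *)

(* Defs.v *)
From mathcomp Require Import all_boot.

Set Implicit Arguments.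
Unset Strict Implicit.
Unset Printing Implicit Defensive.

Definition ncolors (r s i : nat) : nat := if odd i then s else r.

(* The pair (i, c) stands for the part i.+1 in color c; parts of a partition
   of n lie between 1 and n. *)
Definition colored_part (r s n : nat) : finType :=
  {i : 'I_n & 'I_(ncolors r s i.+1)}.

(* A multicolored partition of n is given by the multiplicities of its colored
   parts, none of which can exceed n. *)
Definition multicolored_partitions (r s n : nat) :
    {set {ffun colored_part r s n -> 'I_n.+1}} :=
  [set m : {ffun colored_part r s n -> 'I_n.+1} |
    \sum_(u : colored_part r s n) (tag u).+1 * m u == n].

Definition a (r s n : nat) : nat := #|multicolored_partitions r s n|.

Definition quadratic_nonresidue (p b : nat) : Prop :=
  coprime b p /\ ~ (exists x : nat, x ^ 2 = b %[mod p]).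

(* Main.v *)
Require Import Defs.
From mathcomp Require Import all_boot all_order all_algebra.
From mathcomp Require Import zify ring qpoly.

Set Implicit Arguments.
Unset Strict Implicit.
Unset Printing Implicit Defensive.

Import GRing.Theory.

(** Modulo p the generating function is (f_2^j / f_1^(k+1))^p * f_2^5 / f_1^2,
    and f_2^5 / f_1^2 = T := sum_(a in Z) (-1)^a (3a+1) q^(3a^2+2a). The p-th
    power only involves exponents divisible by p, so the coefficient of
    q^(pn+r) only sees exponents e = 3a^2+2a of T with e = r mod p. For these
    3r+1 = 3e+1 = (3a+1)^2 mod p, hence 3r+1 is a residue or p divides the
    coefficient 3a+1.

    The identity for T follows from T f_4 = f_4^3 phi(q), where
    phi(q) = sum_n q^(n^2) = f_2^5 / (f_1 f_4)^2. With the theta series of f_4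
    (pentagonal numbers) and of f_4^3 (Jacobi), both sides become lattice sums,
    which are matched through 3 (M^2 + 2 n^2) = (M - 2n)^2 + 2 (M + n)^2.

    Power series are replaced by a commutative ring A with an element q such
    that q^N = 0: all infinite sums and products are then finite, and the
    identities used are instances of a finite Jacobi triple product that holds
    in every commutative ring. *)

Local Open Scope ring_scope.

(** * The finite Jacobi triple product *)

Section QBinomial.
Variables (A : comNzRingType) (Q : A).

Definition qpoch (n : nat) : A := \prod_(i < n) (1 - Q ^+ i.+1).

(** The Gaussian binomial, given by a Pascal recurrence so that it makes sense in every ring,
    without division. *)
Fixpoint qbin (n k : nat) : A :=
  match n, k with
  | _, 0 => 1
  | 0, _.+1 => 0
  | n'.+1, k'.+1 => qbin n' k'.+1 + Q ^+ (n' - k') * qbin n' k'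
  end.

Lemma qbinn0 n : qbin n 0 = 1. Proof. by case: n. Qed.

Lemma qbinS n k : qbin n.+1 k.+1 = qbin n k.+1 + Q ^+ (n - k) * qbin n k.
Proof. by []. Qed.

Lemma qbin_small n k : (n < k)%N -> qbin n k = 0.
Proof.
elim: n k => [|n IHn] [|k] //= ltnk.
by rewrite !IHn ?mulr0 ?addr0 //; lia.
Qed.

(** The mirror Pascal rule: the defining rule drives the induction on [a] in [finite_jtp], this one
    the induction on [b]. *)
Lemma qbinSr n k : qbin n.+1 k.+1 = qbin n k + Q ^+ k.+1 * qbin n k.+1.
Proof.
elim: n k => [|n IHn] k; first by case: k => [|k] /=; rewrite ?mulr0 ?mulr1 ?addr0 ?add0r.
case: k => [|k].
  have e1 : qbin n.+2 1 = qbin n.+1 1 + Q ^+ n.+1 by rewrite qbinS qbinn0 mulr1.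
  have e2 : qbin n.+1 1 = qbin n 1 + Q ^+ n by rewrite qbinS qbinn0 mulr1 subn0.
  have e3 := IHn 0%N; rewrite qbinn0 expr1 in e3.
  by rewrite e1 {1}e3 e2 qbinn0 expr1 exprS; ring.
have e1 : qbin n.+2 k.+2 = qbin n.+1 k.+2 + Q ^+ (n - k) * qbin n.+1 k.+1.
  by rewrite qbinS subSS.
rewrite e1 {1}IHn {1}(IHn k) (qbinS n k) (qbinS n k.+1).
have [ltnk|lekn] := ltnP n k.+1.
  by rewrite !(@qbin_small n k.+1) ?(@qbin_small n k.+2) //; [ring|lia].
rewrite !mulrDr !mulrA -!exprD.
have -> : (n - k + k.+1 = n.+1)%N by lia.
have -> : (k.+2 + (n - k.+1) = n.+1)%N by lia.
ring.
Qed.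

Lemma qpochS n : qpoch n.+1 = qpoch n * (1 - Q ^+ n.+1).
Proof. by rewrite /qpoch big_ord_recr. Qed.

Lemma qbin_qpoch n k : (k <= n)%N ->
  qbin n k * (qpoch k * qpoch (n - k)) = qpoch n.
Proof.
elim: n k => [|n IHn] [|k] lekn //.
- by rewrite qbinn0 /qpoch !big_ord0 !mulr1.
- by rewrite qbinn0 subn0 /qpoch big_ord0 !mul1r.
have lekn' : (k <= n)%N by [].
rewrite qbinS mulrDl subSS (qpochS k) (qpochS n).
have -> : Q ^+ (n - k) * qbin n k * (qpoch k * (1 - Q ^+ k.+1) * qpoch (n - k))
   = qpoch n * (Q ^+ (n - k) * (1 - Q ^+ k.+1)).
  by rewrite -(IHn k lekn'); ring.
have [ltkn|gekn] := ltnP k n; last first.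
  have -> : k = n by lia.
  rewrite qbin_small // subnn expr0; ring.
have := IHn k.+1 ltkn; rewrite (qpochS k) => IH.
have -> : (n - k = (n - k.+1).+1)%N by lia.
rewrite (qpochS (n - k.+1)).
set y := Q ^+ (n - k.+1).+1.
have -> : Q ^+ n.+1 = y * Q ^+ k.+1 by rewrite -exprD; congr (_ ^+ _); lia.
by rewrite -IH; ring.
Qed.

(** The term of degree [k - b] in [z]. Since [z] need not be invertible, negative powers are
    expressed through [w], which plays the role of [x * v * Q / z]. *)
Definition jtp_term (x z v w : A) (a b k : nat) : A :=
  if (b <= k)%N then z ^+ (k - b) * x ^+ (a + b - k) * v ^+ b * Q ^+ 'C(k - b, 2)
  else w ^+ (b - k) * v ^+ k * x ^+ a * Q ^+ 'C(b - k, 2).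

Theorem finite_jtp (x z v w : A) (a b : nat) : z * w = x * v * Q ->
  (\prod_(i < a) (x + z * Q ^+ i)) * (\prod_(i < b) (v + w * Q ^+ i)) =
  \sum_(k < (a + b).+1) qbin (a + b) k * jtp_term x z v w a b k.
Proof.
move=> zw; elim: b => [|b IHb].
  (* For [b = 0] this is the q-binomial theorem, by induction on [a]. *)
  rewrite big_ord0 mulr1 addn0.
  under [RHS]eq_bigr => k _ do rewrite /jtp_term leq0n subn0 addn0 expr0 mulr1.
  elim: a => [|a IHa]; first by rewrite big_ord0 big_ord1 !expr0 !mulr1.
  rewrite big_ord_recr IHa /= mulrDr !mulr_suml.
  rewrite [RHS]big_ord_recl [in RHS]/= big_ord_recl /= !qbinn0.
  under [X in _ = _ + X]eq_bigr => k _ do rewrite mulrDl.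
  rewrite big_split /= [X in _ = _ + (X + _)]big_ord_recr /= qbin_small // mul0r addr0.
  rewrite addrA; congr (_ + _ + _).
  - by rewrite !expr0 !subn0 exprSr; ring.
  - apply: eq_bigr => k _; rewrite /bump /= add1n subSS.
    have -> : (a - k = (a - k.+1).+1)%N by have := ltn_ord k; lia.
    by rewrite [x ^+ _.+1]exprSr; ring.
  - apply: eq_bigr => k _.
    have lek : (k <= a)%N by have := ltn_ord k; lia.
    rewrite /bump leq0n add1n add0n binS bin1 exprD subSS exprSr.
    have -> : Q ^+ a = Q ^+ (a - k) * Q ^+ k by rewrite -exprD subnK.
    ring.
rewrite big_ord_recr /= mulrA IHb addnS mulrDr !mulr_suml.
rewrite [RHS]big_ord_recl qbinn0.
under [X in _ = _ + X]eq_bigr => k _ do rewrite lift0 qbinSr mulrDl.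
rewrite big_split /= [X in _ = _ + (_ + X)]big_ord_recr /=.
rewrite (@qbin_small _ (a + b).+1) // mulr0 mul0r addr0.
rewrite addrCA; congr (_ + _).
  apply: eq_bigr => k _; rewrite /jtp_term !subSS ltnS addnS subSS.
  by case: (leqP b k) => _; rewrite [v ^+ _.+1]exprSr; ring.
(* In the new factor [v + w * Q ^+ b], the summand [v] shifts [k] by one, and the other summand
   keeps [k] and yields [Q ^+ k]: these are the two halves of [qbinSr]. *)
have key k : (k <= a + b)%N -> jtp_term x z v w a b k * (w * Q ^+ b) =
    Q ^+ k * jtp_term x z v w a b.+1 k.
  move=> lek; rewrite /jtp_term.
  case: (ltngtP b k) => h.
  - have [d dE] : exists d, (k = b + d.+1)%N by exists (k - b.+1)%N; lia.
    have [c cE] : exists c, (a = d.+1 + c)%N by exists (a - d.+1)%N; lia.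
    subst k a.
    have -> : (b + d.+1 - b = d.+1)%N by lia.
    have -> : (b + d.+1 - b.+1 = d)%N by lia.
    have -> : (d.+1 + c + b - (b + d.+1) = c)%N by lia.
    have -> : (d.+1 + c + b.+1 - (b + d.+1) = c.+1)%N by lia.
    rewrite binS bin1 !exprD !exprS.
    transitivity (z * w * (z ^+ d * x ^+ c * v ^+ b * (Q ^+ 'C(d, 2) * Q ^+ d) * Q ^+ b));
      first ring.
    by rewrite zw; ring.
  - have [d dE] : exists d, (b = k + d.+1)%N by exists (b - k.+1)%N; lia.
    subst b.
    have -> : (k + d.+1 - k = d.+1)%N by lia.
    have -> : ((k + d.+1).+1 - k = d.+2)%N by lia.
    rewrite (binS d.+1) bin1 !exprD !exprS; ring.
  - subst k; rewrite subnn subSnn addnK !bin_small // !expr0; ring.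
rewrite big_ord_recl /= qbinn0 !mul1r; congr (_ + _).
  by rewrite key // expr0 mul1r.
apply: eq_bigr => k _; rewrite -mulrA key; first ring.
by rewrite /bump leq0n add1n; exact: ltn_ord k.
Qed.

End QBinomial.

(** * Theta series in a nilpotent variable *)

Lemma bin2_sqr m : ('C(m, 2) * 2 + m = m * m)%N.
Proof. by elim: m => // m IHm; rewrite binS bin1; nia. Qed.

Definition zrange (n : nat) : seq int :=
  [seq i%:Z - n%:Z | i <- iota 0 (n + n).+1].

Lemma mem_zrange n (j : int) : (j \in zrange n) = (`|j| <= n)%N.
Proof.
apply/mapP/idP => [[i]|lejn].
  by rewrite mem_iota => hi ->; lia.
exists (absz (j + n%:Z)); last by lia.
by rewrite mem_iota; lia.
Qed.

Lemma zrange_uniq n : uniq (zrange n).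
Proof. by rewrite map_inj_uniq ?iota_uniq // => i j; lia. Qed.

Lemma big_zrange (A : nmodType) n (G : int -> A) :
  \sum_(j <- zrange n) G j = \sum_(k < (n + n).+1) G (k%:Z - n%:Z).
Proof.
rewrite big_map -(big_mkord predT (fun k : nat => G (k%:Z - n%:Z))).
by rewrite /index_iota subn0.
Qed.

(** Allows the box of lattice points to be replaced by its images under affine maps, which agree
    with it only where the summand is nonzero. *)
Lemma eq_big_support (A : nmodType) (I : eqType) (F : I -> A) (s t : seq I) :
  uniq s -> uniq t -> (forall x, F x != 0 -> (x \in s) = (x \in t)) ->
  \sum_(x <- s) F x = \sum_(x <- t) F x.
Proof.
move=> us ut st.
have supp u : \sum_(x <- u) F x = \sum_(x <- u | F x != 0) F x.
  rewrite [RHS]big_mkcond; apply: eq_bigr => x _.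
  by case: eqP.
rewrite !supp -[LHS]big_filter -[RHS]big_filter; apply: perm_big.
apply: uniq_perm; rewrite ?filter_uniq // => x; rewrite !mem_filter.
by case: (boolP (F x != 0)) => //= /st.
Qed.

Section Nilpotent.
Variables (A : comNzRingType) (q : A) (N : nat).
Hypothesis qN : q ^+ N = 0.

Lemma nil_gt0 : (0 < N)%N.
Proof. by case: N qN => // /eqP; rewrite expr0 oner_eq0. Qed.

Lemma expr_nil m : (N <= m)%N -> q ^+ m = 0.
Proof. by move=> leNm; rewrite -(subnK leNm) exprD qN mulr0. Qed.

(** The infinite product $f_c$: for $c > 0$ all factors from the [N]-th on are 1 because
    [q ^+ N = 0]. *)
Definition eulerf (c : nat) : A := qpoch (q ^+ c) N.

Lemma qpoch_nil c L : (0 < c)%N -> (N <= L)%N -> qpoch (q ^+ c) L = eulerf c.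
Proof.
move=> c_gt0 leNL; rewrite -(subnK leNL) addnC.
elim: (L - N)%N => [|d IHd]; first by rewrite addn0.
by rewrite addnS qpochS IHd -exprM expr_nil ?subr0 ?mulr1 //; nia.
Qed.

Lemma geom_nil m : (0 < m)%N -> (1 - q ^+ m) * \sum_(j < N) q ^+ (m * j) = 1.
Proof.
move=> m_gt0; apply: oppr_inj; rewrite -mulNr opprB.
under eq_bigr => j _ do rewrite exprM.
by rewrite -subrX1 -exprM expr_nil ?sub0r //; nia.
Qed.

Lemma eulerf_invertible c : (0 < c)%N -> exists u, eulerf c * u = 1.
Proof.
move=> c_gt0; exists (\prod_(i < N) \sum_(j < N) q ^+ (c * i.+1 * j)).
rewrite -big_split big1 //= => i _.
by rewrite -exprM geom_nil // muln_gt0 c_gt0.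
Qed.

Lemma eulerf_lreg c : (0 < c)%N -> GRing.lreg (eulerf c).
Proof.
case/eulerf_invertible => u uP x y /(congr1 ( *%R u)).
by rewrite !mulrA [u * _]mulrC uP !mul1r.
Qed.

(** The indices [k], [n - k] and [n] are all at least [N], so the three products in [qbin_qpoch]
    equal [eulerf c], and one of them cancels. *)
Lemma qbin_eulerf c n k : (0 < c)%N -> (N <= k)%N -> (N + k <= n)%N ->
  eulerf c * qbin (q ^+ c) n k = 1.
Proof.
move=> c_gt0 leNk leNkn.
have /(qbin_qpoch (q ^+ c)) : (k <= n)%N by lia.
rewrite !qpoch_nil //; try lia.
move=> H; apply: (eulerf_lreg c_gt0).
by rewrite mulr1 -[RHS]H; ring.
Qed.

Lemma qbin_limit c n (F : nat -> A) : (0 < c)%N ->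
  (forall k, F k != 0 -> (N <= k)%N && (N + k <= n)%N) ->
  eulerf c * (\sum_(k < n.+1) qbin (q ^+ c) n k * F k) = \sum_(k < n.+1) F k.
Proof.
move=> c_gt0 suppF; rewrite mulr_sumr; apply: eq_bigr => k _.
have [->|/suppF /andP[h1 h2]] := eqVneq (F k) 0; first by rewrite !mulr0.
by rewrite mulrA qbin_eulerf // mul1r.
Qed.

(** With [N.*2] factors on each side, the terms with $|j| \le N$ sit at indices $k = j + 2N$ between
    $N$ and $3N$, where [qbin_eulerf] applies; the others vanish. *)
Lemma jtp_nil c (z w : A) (t : int -> A) : (0 < c)%N -> z * w = q ^+ c ->
  (forall m : nat, t m%:Z = z ^+ m * q ^+ (c * 'C(m, 2))) ->
  (forall m : nat, t (- m%:Z) = w ^+ m * q ^+ (c * 'C(m, 2))) ->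
  (forall j, (N < `|j|)%N -> t j = 0) ->
  eulerf c * ((\prod_(i < N.*2) (1 + z * q ^+ (c * i))) *
              (\prod_(i < N.*2) (1 + w * q ^+ (c * i)))) =
  \sum_(j <- zrange N.*2) t j.
Proof.
move=> c_gt0 zw tpos tneg tnil.
under eq_bigr => i _ do rewrite exprM.
under [X in _ * (_ * X)]eq_bigr => i _ do rewrite exprM.
rewrite finite_jtp ?mul1r //.
have termE k : jtp_term (q ^+ c) 1 z 1 w N.*2 N.*2 k = t (k%:Z - (N.*2)%:Z).
  rewrite /jtp_term -!exprM !expr1n !mulr1.
  case: leqP => h; first by rewrite -tpos; congr t; lia.
  by rewrite -tneg; congr t; lia.
rewrite qbin_limit // ?big_zrange; first by apply: eq_bigr => k _.
move=> k; rewrite termE.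
by apply: contraNT => h; rewrite tnil //; lia.
Qed.

Definition zsgn (j : int) : A := (-1) ^+ `|j|%N.
Definition phi_series : A := \sum_(n <- zrange N.*2) q ^+ absz (n * n).
Definition pent_series : A := \sum_(b <- zrange N.*2)
  zsgn b * q ^+ absz (6 * (b * b) + 2 * b).

Lemma phi_product :
  eulerf 2 * (\prod_(i < N.*2) (1 + q ^+ (2 * i).+1)) ^+ 2 = phi_series.
Proof.
rewrite expr2.
under eq_bigr => i _ do rewrite exprS.
apply: jtp_nil => //.
- by move=> m; rewrite -exprD; congr (_ ^+ _); have := bin2_sqr m; nia.
- by move=> m; rewrite -exprD; congr (_ ^+ _); have := bin2_sqr m; nia.
- by move=> j Nj; rewrite expr_nil //; nia.
Qed.

Lemma pent_product : pent_series = eulerf 4.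
Proof.
rewrite /pent_series -(@jtp_nil 12 (- q ^+ 8) (- q ^+ 4)
  (fun b => zsgn b * q ^+ absz (6 * (b * b) + 2 * b))) //.
(* The exponents congruent to 4, 8 and 0 modulo 12 in the three products together run through the
   multiples of 4. *)
- rewrite -(@qpoch_nil 12 N.*2) //; last by lia.
  rewrite -(@qpoch_nil 4 (N.*2 * 3)) //; last by lia.
  elim: (N.*2) => [|n IHn]; first by rewrite /qpoch !big_ord0 !mulr1.
  have -> : (n.+1 * 3 = (n * 3).+3)%N by lia.
  rewrite !qpochS !big_ord_recr /= -IHn.
  rewrite !mulNr -!exprM -!exprD.
  set P := \prod_(i < n) _; set P' := \prod_(i < n) _.
  have -> : (4 * (n * 3).+1 = 4 + 12 * n)%N by lia.
  have -> : (4 * (n * 3).+2 = 8 + 12 * n)%N by lia.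
  have -> : (4 * (n * 3).+3 = 12 * n.+1)%N by lia.
  ring.
- by rewrite mulrNN -exprD.
- move=> m; rewrite exprNn -mulrA -exprM -exprD /zsgn; congr (_ * _ ^+ _).
  by have := bin2_sqr m; nia.
- move=> m; rewrite exprNn -mulrA -exprM -exprD /zsgn; congr (_ ^+ _ * _ ^+ _); first by lia.
  by have := bin2_sqr m; nia.
- by move=> j Nj; rewrite expr_nil ?mulr0 //; nia.
Qed.

(* The triple product at z = -1 contains the factor 1 + z = 0. *)
Lemma theta_zero c : (0 < c)%N ->
  \sum_(j <- zrange N.*2) zsgn j * q ^+ absz (c%:Z * (j * (j - 1))) = 0.
Proof.
move=> c_gt0; have N_gt0 := nil_gt0.
rewrite -(@jtp_nil (2 * c) (-1) (- q ^+ (2 * c))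
  (fun j => zsgn j * q ^+ absz (c%:Z * (j * (j - 1))))).
- rewrite -(prednK (_ : 0 < N.*2)%N); last by lia.
  by rewrite big_ord_recl muln0 expr0 mulr1 subrr !mul0r mulr0.
- by rewrite muln_gt0.
- by rewrite mulrNN mul1r.
- by move=> m; congr (_ * _ ^+ _); have := bin2_sqr m; nia.
- move=> m; rewrite exprNn -mulrA -exprM -exprD /zsgn; congr (_ ^+ _ * _ ^+ _); first by lia.
  by have := bin2_sqr m; nia.
- move=> j Nj; rewrite expr_nil ?mulr0 //.
  have : (N <= absz (j * (j - 1))%R)%N by nia.
  by move=> le_N; rewrite abszM; apply: leq_trans le_N (leq_pmull _ c_gt0).
Qed.

End Nilpotent.

(** * Jacobi's identity for the cube of the Euler product *)

Lemma qbin_polyC (A : comNzRingType) (Q : A) n k :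
  qbin Q%:P n k = (qbin Q n k)%:P.
Proof.
elim: n k => [|n IHn] [|k] //=.
by rewrite !IHn polyCD polyCM polyC_exp.
Qed.

Lemma zsgnD (A : comNzRingType) (i j : int) : zsgn A (i + j) = zsgn A i * zsgn A j.
Proof.
rewrite /zsgn -exprD -signr_odd -[in RHS]signr_odd; congr (_ ^+ nat_of_bool _).
by lia.
Qed.

Lemma zsgnN (A : comNzRingType) (j : int) : zsgn A (- j) = zsgn A j.
Proof. by rewrite /zsgn abszN. Qed.

Section JacobiCube.
Variables (A : comNzRingType) (q : A) (N : nat).
Hypothesis qN : q ^+ N = 0.

Let n := N.*2.
Let tri (j : int) := absz (2 * (j * (j - 1))).

(* The triple product with a polynomial variable for z; it has a simple zero at z = 1. *)
Let jtpX :
  (\prod_(i < n) (1 - 'X * (q ^+ 4)%:P ^+ i)) *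
  (\prod_(i < n) (- 'X + (q ^+ 4)%:P ^+ i.+1)) =
  \sum_(k < (n + n).+1) (qbin (q ^+ 4) (n + n) k *
    ((-1) ^+ k * q ^+ tri (k%:Z - n%:Z)))%:P * 'X^k :> {poly A}.
Proof.
(* Each factor in $1/X$ is multiplied by $-X$, which amounts to [v = z = - 'X] and [w = Q]; only
   natural powers of ['X] then occur. *)
have H : - 'X * (q ^+ 4)%:P = 1 * - 'X * (q ^+ 4)%:P :> {poly A} by ring.
have := finite_jtp n n H.
under eq_bigr => i _ do rewrite mulNr.
under [X in _ * X = _ -> _]eq_bigr => i _ do rewrite -exprS.
move=> ->; apply: eq_bigr => k _.
rewrite qbin_polyC (polyCM (qbin _ _ _)) -[RHS]mulrA; congr (_ * _).
rewrite /jtp_term !expr1n !mulr1 -!polyC_exp -!exprM !(exprNn 'X) (polyCM ((-1) ^+ k)).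
have -> : ((-1) ^+ k)%:P = (-1) ^+ k :> {poly A} by rewrite polyC_exp polyCN.
case: leqP => lenk.
  rewrite mulrACA -!exprD subnK // mulrAC; congr (_ * _%:P * _); congr (_ ^+ _).
  by have := bin2_sqr (k - n); rewrite /tri; nia.
have -> : tri (k%:Z - n%:Z) = (4 * (n - k) + 4 * 'C(n - k, 2))%N.
  by have := bin2_sqr (n - k); rewrite /tri; nia.
by rewrite exprD (polyCM (q ^+ (4 * (n - k)))); ring.
Qed.

Let sum_limit (e : nat -> A) :
  eulerf q N 4 * (\sum_(k < (n + n).+1) qbin (q ^+ 4) (n + n) k *
    ((-1) ^+ k * q ^+ tri (k%:Z - n%:Z) * e k)) =
  \sum_(k < (n + n).+1) zsgn A (k%:Z - n%:Z) * q ^+ tri (k%:Z - n%:Z) * e k.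
Proof.
have N_gt0 := nil_gt0 qN.
rewrite (qbin_limit qN (F := fun k => (-1) ^+ k * q ^+ tri (k%:Z - n%:Z) * e k)) //.
  apply: eq_bigr => k _; congr (_ * _ * _).
  by rewrite /zsgn -signr_odd -[RHS]signr_odd; congr (_ ^+ nat_of_bool _); rewrite /n; lia.
move=> k; apply: contraNT => h.
by rewrite (expr_nil qN) ?mulr0 ?mul0r // /tri; rewrite /n in h *; nia.
Qed.

(** The zero at 1 is the factor [i = 0] of the first product. In the second product each factor at 1
    is $-(1 - q^{4(i+1)})$, and the signs cancel since [n] is even. *)
Let jtpX_factor : exists2 R : {poly A},
  (\prod_(i < n) (1 - 'X * (q ^+ 4)%:P ^+ i)) *
  (\prod_(i < n) (- 'X + (q ^+ 4)%:P ^+ i.+1)) = (1 - 'X) * R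
  & R.[1] = eulerf q N 4 ^+ 2.
Proof.
have [m nE leNm] : exists2 m, n = m.+1 & (N <= m)%N.
  by exists n.-1; have := nil_gt0 qN; rewrite /n; lia.
exists ((\prod_(i < m) (1 - 'X * (q ^+ 4)%:P ^+ i.+1)) *
        (\prod_(i < n) (- 'X + (q ^+ 4)%:P ^+ i.+1))).
  rewrite nE big_ord_recl expr0 mulr1 mulrA.
  by under eq_bigr => i _ do rewrite lift0.
rewrite hornerM !horner_prod expr2 -{1}(@qpoch_nil _ _ _ qN 4 m) //.
rewrite -(@qpoch_nil _ _ _ qN 4 n) // /n; last by rewrite -addnn leq_addr.
congr (_ * _).
  by apply: eq_bigr => i _; rewrite -polyC_exp !hornerE.
transitivity (\prod_(i < N.*2) (- 1 * (1 - q ^+ 4 ^+ i.+1))); last first.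
  by rewrite big_split /= prodr_const card_ord -signr_odd odd_double expr0 mul1r.
by apply: eq_bigr => i _; rewrite -polyC_exp !hornerE; ring.
Qed.

(** Differentiating [jtpX] at 1 leaves [- R.[1]] on the product side and weights each term by [k] on
    the other. *)
Lemma jacobi_cube :
  \sum_(j <- zrange n) zsgn A j * j%:~R * q ^+ tri j = - eulerf q N 4 ^+ 3.
Proof.
have [R RE R1] := jtpX_factor.
have := congr1 (fun p => eulerf q N 4 * p^`().[1]) jtpX.
rewrite RE derivM raddf_sum horner_sum derivB derivX derivC sub0r.
rewrite hornerD !hornerM [(1 - 'X).[1]]hornerD !hornerN hornerX !hornerC subrr.
rewrite mul0r addr0 R1 mulN1r.
under [X in _ = _ * X -> _]eq_bigr => k _.
  rewrite /= derivM derivC mul0r add0r derivXn hornerM hornerC hornerMn hornerXn expr1n -mulrA.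
  over.
rewrite (sum_limit (fun k => k%:R)) => H.
have <- : eulerf q N 4 * - eulerf q N 4 ^+ 2 = - eulerf q N 4 ^+ 3 by ring.
(* The weight is [k = j + n], and the part constant in [j] is [n] times a vanishing theta sum. *)
rewrite H -(addr0 (\sum_(_ <- _) _)) -[X in _ + X](mulr0 n%:R).
rewrite -[X in _ * X](theta_zero qN (isT : 0 < 2)%N).
rewrite !big_zrange mulr_sumr -big_split; apply: eq_bigr => k _ /=.
by rewrite rmorphB /=; ring.
Qed.
End JacobiCube.

(** * The series of f_2^5 / f_1^2 *)

Section Quintuple.
Variables (A : comNzRingType) (q : A) (N : nat).
Hypothesis qN : q ^+ N = 0.
Hypothesis two_lreg : GRing.lreg (2 : A).

Definition quint_series : A := \sum_(a <- zrange N.*2)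
  zsgn A a * (3 * a + 1)%:~R * q ^+ absz (3 * (a * a) + 2 * a).

Let s := zrange N.*2.
Let P : seq (int * int) := [seq (a, b) | a <- s, b <- s].
(* The summand x.2 of the weight changes no sum, as it is odd in x.2; it makes
   the weight equal to u below. *)
Let G (x : int * int) : A := zsgn A x.1 * (1 - 2 * x.1 + x.2)%:~R *
   q ^+ absz (2 * (x.1 * (x.1 - 1)) + x.2 * x.2).

Let P_uniq : uniq P.
Proof. by apply: allpairs_uniq => [||[a b] [c d]]; rewrite ?zrange_uniq. Qed.

Let mem_P x : (x \in P) = (`|x.1| <= N.*2)%N && (`|x.2| <= N.*2)%N.
Proof.
rewrite -!mem_zrange; case: x => a b /=.
by apply/allpairsP/andP => [[[c d] [/= hc hd [-> ->]]]|[ha hb]] //; exists (a, b).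
Qed.

Let sum_P (F H : int -> A) :
  \sum_(x <- P) F x.1 * H x.2 = (\sum_(a <- s) F a) * (\sum_(b <- s) H b).
Proof. by rewrite big_allpairs big_distrlr. Qed.

(** The support lies well inside the box of radius [N.*2], which leaves room for the preimages under
    [h1], [h2] and [h0]. *)
Let G_support x : G x != 0 -> (`|x.1| <= N)%N && (`|x.2| < N)%N.
Proof.
have N_gt0 := nil_gt0 qN.
apply: contraNT => h; rewrite /G (expr_nil qN) ?mulr0 //; move: h.
case: x => j m /=; rewrite negb_and -ltnNge -leqNgt => /orP[] h; last first.
  have : (0 <= j * (j - 1))%R by nia.
  have : (absz m <= absz (m * m)%R)%N by nia.
  by lia.
have : (N <= absz (j * (j - 1))%R)%N by nia.
by nia.
Qed.

(* With M = 1 - 2 j, u = M + n and v = M - 2 n are congruent modulo 3. The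
   points with u = v = 1 (resp. -1, resp. 0) modulo 3 are the images of h1
   (resp. h2, resp. h0): h1 and h2 both contribute the product of the two
   series, and h0 contributes 0. *)
Let h1 (x : int * int) : int * int := (- x.1 - x.2, x.1 - 2 * x.2).
Let h2 (x : int * int) : int * int := (1 + x.1 + x.2, 2 * x.2 - x.1).
Let h0 (x : int * int) : int * int := (x.2 - x.1, x.1 + 2 * x.2 - 1).

Lemma lattice_dissection :
  2 * (quint_series * pent_series q N) = 2 * eulerf q N 4 ^+ 3 * phi_series q N.
Proof.
have N_gt0 := nil_gt0 qN.
transitivity (\sum_(x <- P) G x); last first.
  transitivity (\sum_(x <- P)
    ((zsgn A x.1 * (1 - 2 * x.1)%:~R * q ^+ absz (2 * (x.1 * (x.1 - 1)))) *
       q ^+ absz (x.2 * x.2) +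
     zsgn A x.1 * q ^+ absz (2 * (x.1 * (x.1 - 1))) * (x.2%:~R * q ^+ absz (x.2 * x.2)))).
    apply: eq_bigr => x _; rewrite /G.
    have -> : absz (2 * (x.1 * (x.1 - 1)) + x.2 * x.2) =
        (absz (2 * (x.1 * (x.1 - 1)))%R + absz (x.2 * x.2)%R)%N by nia.
    by rewrite exprD rmorphD /=; ring.
  rewrite big_split /=.
  rewrite (sum_P
    (fun j => zsgn A j * (1 - 2 * j)%:~R * q ^+ absz (2 * (j * (j - 1))))
    (fun n => q ^+ absz (n * n))).
  rewrite (sum_P (fun j => zsgn A j * q ^+ absz (2 * (j * (j - 1))))
    (fun n => n%:~R * q ^+ absz (n * n))).
  rewrite (theta_zero qN (isT : 0 < 2)%N) mul0r addr0; congr (_ * _).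
  transitivity (\sum_(j <- s) zsgn A j * q ^+ absz (2%:Z * (j * (j - 1))) - 2 *
     \sum_(j <- s) zsgn A j * j%:~R * q ^+ absz (2 * (j * (j - 1)))); last first.
    by rewrite (theta_zero qN (isT : 0 < 2)%N) jacobi_cube // sub0r mulrN opprK.
  rewrite mulr_sumr -sumrB; apply: eq_bigr => j _.
  by rewrite rmorphB rmorphM /=; ring.
have C_mem x : G x != 0 -> (x \in P) = (x \in map h1 P ++ map h2 P ++ map h0 P).
  move=> /G_support /andP[hj hm]; rewrite mem_P mem_cat (mem_cat _ (map h2 P)).
  case: x hj hm => j m; rewrite [(_, _).1]/= [(_, _).2]/= => hj hm.
  rewrite [LHS](_ : _ && _ = true); last by lia.
  apply/esym/or3P.
  (* Here [u = 1 - 2 * j + m] is congruent to [1 + j + m] modulo 3, so [m + j] selects the map; [c]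
     is the second coordinate of the preimage. *)
  have [c [cE|[cE|cE]]] : exists c : int,
      m + j = - 3 * c \/ m + j = 1 + 3 * c \/ m + j = 3 * c - 1.
    have /= := divz_eq (m + j) 3; have := ltz_pmod (m + j) (isT : 0 < 3 :> int).
    have := modz_ge0 (m + j) (isT : 3 != 0 :> int).
    set d := divz _ _; set e := modz _ _ => e0 e3 dE.
    have [e_0|[e_1|e_2]] : e = 0 \/ e = 1 \/ e = 2 by lia.
    + by exists (- d); lia.
    + by exists d; lia.
    + by exists (d + 1); lia.
  + constructor 1; apply/mapP; exists (- j - c, c); last by rewrite /h1 /=; congr pair; lia.
    by rewrite mem_P /=; lia.
  + constructor 2; apply/mapP; exists (j - 1 - c, c); last by rewrite /h2 /=; congr pair; lia.
    by rewrite mem_P /=; lia.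
  + constructor 3; apply/mapP; exists (c - j, c); last by rewrite /h0 /=; congr pair; lia.
    by rewrite mem_P /=; lia.
have C_uniq : uniq (map h1 P ++ map h2 P ++ map h0 P).
  rewrite !cat_uniq !map_inj_uniq ?P_uniq //; first last.
  + by move=> [a b] [c d] [] /= *; congr pair; lia.
  + by move=> [a b] [c d] [] /= *; congr pair; lia.
  + by move=> [a b] [c d] [] /= *; congr pair; lia.
  rewrite !andTb andbT; apply/andP; split; apply/hasPn => x.
  + rewrite mem_cat => /orP[] /mapP[[a b] _ ->]; apply/mapP => -[[c d] _] [] /=; lia.
  + by move=> /mapP[[a b] _ ->]; apply/mapP => -[[c d] _] [] /=; lia.
rewrite (eq_big_support P_uniq C_uniq C_mem).
pose t a := zsgn A a * (3 * a + 1)%:~R * q ^+ absz (3 * (a * a) + 2 * a).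
pose e b := zsgn A b * q ^+ absz (6 * (b * b) + 2 * b).
have te_exp (a b : int) :
    q ^+ absz (3 * (a * a) + 2 * a + (6 * (b * b) + 2 * b)) =
    q ^+ absz (3 * (a * a) + 2 * a) * q ^+ absz (6 * (b * b) + 2 * b).
  by rewrite -exprD; congr (_ ^+ _); nia.
have sum1 : \sum_(x <- map h1 P) G x = quint_series * pent_series q N.
  rewrite -(sum_P t e) big_map; apply: eq_bigr => -[a b] _.
  rewrite /G /h1 /t /e /= zsgnD !zsgnN.
  rewrite [absz (_ + _)](_ : _ = absz (3 * (a * a) + 2 * a + (6 * (b * b) + 2 * b)));
    last by congr absz; ring.
  rewrite te_exp [X in X%:~R](_ : _ = 3 * a + 1); last by ring.
  by ring.
have sum2 : \sum_(x <- map h2 P) G x = quint_series * pent_series q N.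
  rewrite -(sum_P t e) big_map; apply: eq_bigr => -[a b] _.
  rewrite /G /h2 /t /e /= !zsgnD.
  rewrite [absz (_ + _)](_ : _ = absz (3 * (a * a) + 2 * a + (6 * (b * b) + 2 * b)));
    last by congr absz; ring.
  (* The sign of the weight is compensated by the shift by 1 in the first coordinate of [h2]. *)
  rewrite te_exp [X in X%:~R](_ : _ = - (3 * a + 1)); last by ring.
  rewrite rmorphN /= {1}/zsgn expr1.
  by ring.
have sum0 : \sum_(x <- map h0 P) G x = 0.
  (* On [h0] the weight [3 * a] does not involve [b], so the sum splits and its [b]-part is a
     vanishing theta sum. *)
  transitivity (\sum_(x <- P) zsgn A x.1 * (3 * x.1)%:~R * q ^+ (absz (3 * (x.1 * x.1))).+1 *
     (zsgn A x.2 * q ^+ absz (6%:Z * (x.2 * (x.2 - 1))))).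
    rewrite big_map; apply: eq_bigr => -[a b] _.
    rewrite /G /h0 /= zsgnD zsgnN.
    rewrite [absz (_ + _)](_ : _ = ((absz (3 * (a * a))%R).+1 + absz (6%:Z * (b * (b - 1)))%R)%N); last by nia.
    rewrite exprD [X in X%:~R](_ : _ = 3 * a); last by ring.
    by ring.
  rewrite (sum_P (fun a => zsgn A a * (3 * a)%:~R * q ^+ (absz (3 * (a * a))).+1)
     (fun b => zsgn A b * q ^+ absz (6%:Z * (b * (b - 1))))).
  by rewrite (theta_zero qN (isT : 0 < 6)%N) mulr0.
by rewrite !big_cat /= sum1 sum2 sum0 addr0 mulrDl mul1r.
Qed.

Lemma eulerf_odd c : (0 < c)%N ->
  (\prod_(i < N.*2) (1 - q ^+ (c * (2 * i).+1))) * eulerf q N (2 * c) = eulerf q N c.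
Proof.
move=> c_gt0.
rewrite -(@qpoch_nil _ _ _ qN (2 * c) N.*2); try lia.
rewrite -(@qpoch_nil _ _ _ qN c (N.*2 * 2)); try lia.
elim: (N.*2) => [|n IHn]; first by rewrite /qpoch !big_ord0 mulr1.
have -> : (n.+1 * 2 = (n * 2).+2)%N by lia.
rewrite big_ord_recr !qpochS /= -IHn -!exprM.
have -> : (2 * c * n.+1 = c * (n * 2).+2)%N by lia.
by rewrite [(2 * n)%N]mulnC; ring.
Qed.

Theorem quintuple_special :
  eulerf q N 2 ^+ 5 = eulerf q N 1 ^+ 2 * quint_series.
Proof.
have dissect := lattice_dissection.
rewrite pent_product // -phi_product // -mulrA in dissect.
have {dissect}/(eulerf_lreg qN (isT : 0 < 4)%N) main :
   eulerf q N 4 * quint_series = eulerf q N 4 *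
   (eulerf q N 4 ^+ 2 * (eulerf q N 2 * (\prod_(i < N.*2) (1 + q ^+ (2 * i).+1)) ^+ 2)).
  by apply: two_lreg; rewrite [eulerf q N 4 * quint_series]mulrC dissect; ring.
rewrite main.
have o1 := @eulerf_odd 1 isT; have o2 := @eulerf_odd 2 isT.
set Pp := \prod_(i < _) (1 + _).
(* Difference of squares in each odd factor; with [eulerf_odd] it gives $\prod (1 + q^{2i+1}) =
   f_2^2 / (f_1 f_4)$. *)
have PE : Pp * \prod_(i < N.*2) (1 - q ^+ (1 * (2 * i).+1)) =
  \prod_(i < N.*2) (1 - q ^+ (2 * (2 * i).+1)).
  rewrite -big_split; apply: eq_bigr => i _ /=.
  by rewrite mul1n [(2 * _.+1)%N]mulnC exprM; ring.
have key : Pp * eulerf q N 1 * eulerf q N 4 = eulerf q N 2 ^+ 2.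
  by rewrite -o1 mulrA PE mulrAC o2 muln1 expr2.
transitivity (eulerf q N 2 * (Pp * eulerf q N 1 * eulerf q N 4) ^+ 2).
  by rewrite key; ring.
ring.
Qed.
End Quintuple.

(** * Partitions and congruences *)

Definition part_gf (A : comNzRingType) (q : A) (r s n : nat) : A :=
  \prod_(u : colored_part r s n) \sum_(j < n.+1) q ^+ ((tag u).+1 * j).

(** Expanding the product of sums gives one monomial for each multiplicity function, with the
    partitioned number as exponent. *)
Lemma coef_part_gf (F : comNzRingType) r s n :
  (part_gf ('X : {poly F}) r s n)`_n = (a r s n)%:R.
Proof.
rewrite /part_gf bigA_distr_bigA coef_sum /a -sum1_card natr_sum [RHS]big_mkcond /=.
apply: eq_bigr => f _; rewrite inE -expr_sum coefXn eq_sym.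
by case: eqP.
Qed.

Lemma part_gfE (A : comNzRingType) (q : A) r s n :
  part_gf q r s n =
  \prod_(i < n) (\sum_(j < n.+1) q ^+ (i.+1 * j)) ^+ ncolors r s i.+1.
Proof.
pose G (i : 'I_n) (c : 'I_(ncolors r s i.+1)) : A := \sum_(j < n.+1) q ^+ (i.+1 * j).
transitivity (\prod_(i < n) \prod_(c < ncolors r s i.+1) G i c).
  by rewrite (sig_big_dep _ _ G).
by apply: eq_bigr => i _; rewrite prodr_const card_ord.
Qed.

(** The inverse [D n] of the generating function is $O^s f_2^r$, where [O] collects the odd factors
    and $O f_2 = f_1$. *)
Lemma part_gf_eulerf (A : comNzRingType) (q : A) r s n : q ^+ n.+1 = 0 ->
  (r <= s)%N ->
  part_gf q r s n * eulerf q n.+1 1 ^+ s = eulerf q n.+1 2 ^+ (s - r).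
Proof.
move=> qN le_rs.
pose D L := \prod_(i < L) (1 - q ^+ i.+1) ^+ ncolors r s i.+1.
have gfD : part_gf q r s n * D n = 1.
  rewrite part_gfE -big_split big1 //= => i _.
  by rewrite -exprMn mulrC geom_nil // expr1n.
have DE d : D (n + d)%N = D n.
  elim: d => [|d IHd]; first by rewrite addn0.
  by rewrite addnS /D big_ord_recr /= (expr_nil qN) ?subr0 ?expr1n ?mulr1 // ltnS leq_addr.
pose O := \prod_(i < n.+1.*2) (1 - q ^+ (1 * (2 * i).+1)).
have DO : D n = O ^+ s * eulerf q n.+1 2 ^+ r.
  (* Factors beyond the [n]-th are 1, so [D n] may be lengthened and its factors grouped in pairs of
     one odd and one even part. *)
  rewrite -(DE (n.+1.*2 * 2 - n)%N) subnKC; last by lia.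
  rewrite -(@qpoch_nil _ _ _ qN 2 n.+1.*2) // /O; last by lia.
  elim: (n.+1.*2) => [|m IHm]; first by rewrite /D /qpoch !big_ord0 !expr1n mulr1.
  have -> : (m.+1 * 2 = (m * 2).+2)%N by lia.
  rewrite /D !big_ord_recr /= -/(D _) IHm qpochS -exprM mul1n !exprMn.
  rewrite /ncolors /= oddM andbF /=.
  have -> : (2 * m.+1 = (m * 2).+2)%N by lia.
  by rewrite [(2 * m)%N]mulnC; ring.
have eE : eulerf q n.+1 2 ^+ s = eulerf q n.+1 2 ^+ r * eulerf q n.+1 2 ^+ (s - r).
  by rewrite -exprD subnKC.
rewrite -(eulerf_odd qN (isT : 0 < 1)%N) muln1 -/O exprMn eE -[RHS]mul1r -gfD DO.
by ring.
Qed.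

(** The [p]-th power map is additive in characteristic [p], so [W ^+ p] is a polynomial in $X^p$. *)
Lemma coef_Frobenius p (W : {poly 'F_p}) i : prime p -> ~~ (p %| i)%N ->
  (W ^+ p)`_i = 0.
Proof.
move=> p_pr ndvd.
have pch : p \in [pchar {poly 'F_p}] by rewrite pchar_poly pchar_Fp.
rewrite -(pFrobenius_autE pch) -[W]coefK poly_def rmorph_sum coef_sum big1 //= => k _.
rewrite pFrobenius_autE exprZn -exprM coefZ coefXn.
case: eqP => [iE|]; last by rewrite mulr0.
by rewrite iE dvdn_mull in ndvd.
Qed.

Lemma in_qpoly_coef (F : comNzRingType) n (P Q : {poly F}) i : (i <= n)%N ->
  in_qpoly 'X^(n.+1) P = in_qpoly 'X^(n.+1) Q -> P`_i = Q`_i.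
Proof.
move=> le_in /(congr1 val) /=; rewrite mk_monic_Xn /= => PQ.
rewrite (Pdiv.RingMonic.rdivp_eq (monicXn F n.+1) P) PQ.
rewrite [in RHS](Pdiv.RingMonic.rdivp_eq (monicXn F n.+1) Q).
by rewrite !coefD !coefMXn !ltnS le_in.
Qed.

Lemma rmorph_quint_series (A B : comNzRingType) (f : {rmorphism A -> B}) q N :
  f (quint_series q N) = quint_series (f q) N.
Proof.
rewrite /quint_series rmorph_sum; apply: eq_bigr => c _.
by rewrite !rmorphM rmorph_int /zsgn !rmorphXn rmorphN1.
Qed.

Lemma rmorph_part_gf (A B : comNzRingType) (f : {rmorphism A -> B}) q r s n :
  f (part_gf q r s n) = part_gf (f q) r s n.
Proof.
rewrite /part_gf rmorph_prod; apply: eq_bigr => u _.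
by rewrite rmorph_sum; apply: eq_bigr => j _; rewrite rmorphXn.
Qed.

Lemma quint_exponent_sqr (c : int) :
  (absz (3 * c + 1)%R ^ 2 = 3 * absz (3 * (c * c) + 2 * c)%R + 1)%N.
Proof.
rewrite -mulnn -abszM.
have e_ge0 : 0 <= 3 * (c * c) + 2 * c by nia.
have -> : (3 * c + 1) * (3 * c + 1) = 3 * (3 * (c * c) + 2 * c) + 1 by ring.
by move: (3 * (c * c) + 2 * c) e_ge0 => e; lia.
Qed.

Lemma quint_series_coef p r N i : prime p ->
  (quadratic_nonresidue p (3 * r + 1) \/ 3 * r + 1 = 0 %[mod p])%N ->
  i = r %[mod p] -> (quint_series ('X : {poly 'F_p}) N)`_i = 0.
Proof.
move=> p_pr hr ir; rewrite /quint_series coef_sum big1 // => c _.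
have -> : zsgn {poly 'F_p} c * (3 * c + 1)%:~R * 'X^(absz (3 * (c * c) + 2 * c)) =
   (zsgn 'F_p c * (3 * c + 1)%:~R)%:P * 'X^(absz (3 * (c * c) + 2 * c)).
  by rewrite polyCM /zsgn polyC_exp polyCN -[((3 * c + 1)%:~R)%:P]/(polyC _) rmorph_int.
rewrite coefCM coefXn; case: eqP => [iE|]; last by rewrite mulr0.
set y := absz (3 * c + 1)%R.
have yE : (y ^ 2 = 3 * r + 1 %[mod p])%N.
  rewrite quint_exponent_sqr -iE.
  by rewrite -modnDml -modnMmr ir modnMmr modnDml.
case: hr => [[_ []]|r0]; first by exists y.
have p_dvd : (p %| y)%N.
  suff : (p %| y ^ 2)%N by rewrite Euclid_dvdX // => /andP[].
  by rewrite /dvdn yE r0 mod0n.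
have y0 : y%:R = 0 :> 'F_p.
  by apply/eqP; rewrite -(dvdn_pcharf (pchar_Fp p_pr)).
(* The exponent is compatible with [r] only if [p] divides [3 * c + 1], and then the coefficient is
   0 in ['F_p]. *)
by rewrite [3 * c + 1]intEsign -/y intrM -pmulrn y0 !mulr0 mul0r.
Qed.

Lemma lreg_two_qpoly p n : prime p -> odd p ->
  GRing.lreg (2 : {poly %/ ('X^(n.+1) : {poly 'F_p})}).
Proof.
move=> p_pr p_odd.
have two : 2%:R != 0 :> 'F_p.
  rewrite -(dvdn_pcharf (pchar_Fp p_pr)); apply/negP => /(@dvdn_leq p 2 isT) le_p2.
  by case: p p_pr p_odd le_p2 => [|[|[|p]]].
pose f := in_qpoly ('X^(n.+1) : {poly 'F_p}).
have H : f (2^-1)%:P * 2 = 1.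
  by rewrite -(rmorph_nat f) -rmorphM -polyC_natr -polyCM mulVf // rmorph1.
by move=> x y /(congr1 ( *%R (f (2^-1)%:P))); rewrite !mulrA H !mul1r.
Qed.

(* The exponents of f_1 and f_2 in the generating function are p (k + 1) + 2
   and p j + 5. *)
Lemma coef_part_gf_Frobenius p k j r s n : prime p -> odd p ->
  s = (k.+1 * p + 2)%N -> s = (r + (p * j + 5))%N ->
  exists W : {poly 'F_p},
    (part_gf 'X r s n)`_n = (W ^+ p * quint_series 'X n.+1)`_n.
Proof.
move=> p_prime p_odd sE srE.
have le_rs : (r <= s)%N by rewrite srE leq_addr.
have sr : (s - r = p * j + 5)%N by rewrite srE addKn.
pose f := in_qpoly ('X^(n.+1) : {poly 'F_p}); pose q := f 'X.
have qN : q ^+ n.+1 = 0.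
  rewrite -rmorphXn; apply/val_inj => /=.
  by rewrite mk_monic_Xn /= Pdiv.Ring.rmodpp // /GRing.comm mulrC.
have two := @lreg_two_qpoly p n p_prime p_odd.
have [u uP] := eulerf_invertible qN (isT : 0 < 1)%N.
(* With [u] the inverse of $f_1$, this is $f_2^j / f_1^{k+1}$; its representative [val w] serves as
   [W]. *)
pose w := u ^+ k.+1 * eulerf q n.+1 2 ^+ j.
have gfE : part_gf q r s n = w ^+ p * quint_series q n.+1.
  have /(congr1 (fun x => u ^+ s * x)) := part_gf_eulerf qN le_rs.
  have us : u ^+ s * eulerf q n.+1 1 ^+ s = 1 by rewrite -exprMn mulrC uP expr1n.
  rewrite mulrCA us mulr1 => ->.
  rewrite sr sE (exprD (eulerf q n.+1 2)) (quintuple_special qN two) /w.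
  have u2 : u ^+ 2 * eulerf q n.+1 1 ^+ 2 = 1 by rewrite -exprMn mulrC uP expr1n.
  rewrite exprMn exprD -!exprM [(j * p)%N]mulnC -[RHS]mulr1 -u2; ring.
have wE : f (val w) = w by apply: val_inj; apply: in_qpoly_small; apply: size_mk_monic.
exists (val w); apply: (in_qpoly_coef (leqnn n)).
by rewrite rmorph_part_gf rmorphM rmorphXn rmorph_quint_series /= -/f wE -/q gfE.
Qed.

Local Close Scope ring_scope.

Theorem theorem1p18 (p r : nat) (p_prime : prime p) (p_ge5 : 5 <= p)
    (r_range : 1 <= r <= p - 1)
    (hr : quadratic_nonresidue p (3 * r + 1) \/ 3 * r + 1 = 0 %[mod p])
    (n k j : nat) (le_jk : j <= k) :
  a (p * (k - j) + (p - 3)) (p * k + (p + 2)) (p * n + r) = 0 %[mod p].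
Proof.
have p_odd : odd p by case: (even_prime p_prime) => // pE; rewrite pE in p_ge5.
set R := p * (k - j) + (p - 3); set S := p * k + (p + 2); set M := p * n + r.
have sE : S = k.+1 * p + 2 by rewrite /S; lia.
have srE : S = R + (p * j + 5) by rewrite /S /R; nia.
apply/eqP; rewrite mod0n -/(dvdn _ _) (dvdn_pcharf (pchar_Fp p_prime)).
have [W WE] := coef_part_gf_Frobenius M p_prime p_odd sE srE.
rewrite -coef_part_gf WE coefM big1 // => i _.
have [/dvdnP[d dE]|ndvd] := boolP (p %| i); last first.
  by rewrite coef_Frobenius // mul0r.
rewrite (quint_series_coef _ p_prime hr) ?mulr0 //.
have := ltn_ord i; rewrite dE /M ltnS => le_dp.
(* Since [r < p], the bound $dp \le pn + r$ forces $d \le n$; the truncated subtraction [n - d] is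
   then exact. *)
have le_dn : d * p <= n * p.
  rewrite leq_pmul2r ?prime_gt0 // -ltnS -(ltn_pmul2r (prime_gt0 p_prime)).
  by rewrite mulSn; lia.
have -> : p * n + r - d * p = (n - d) * p + r by rewrite mulnBl; lia.
by rewrite modnMDl.
Qed.
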